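(* Let $R$ be a commutative ring with $1$, let $n\ge1$, and let $(\mathcal C,\mathbb E,\mathfrak s)$ be a small $R$-linear extriangulated category. Assume that $\mathcal C$ is nonsplit (that is, $\mathbb E\ne0$) and that $\mathcal X$ is a strongly functorially finite and two-sided maximally $n$-orthogonal subcategory of $\mathcal C$. Then the nilpotency index of $\Sigma_{\mathcal X}$ is exactly $n$, and $\mathbb E^{n+1}(\mathcal X,\mathcal X)\neq0$.
   Context: Conventions: all categories are additive; subcategories are full and closed under isomorphisms; $\mathcal X=\operatorname{add}\mathcal X$ means $\mathcal X$ is closed under finite direct sums and direct summands; a category is small if its objects and morphisms form sets. Extriangulated categories $(\mathcal C,\mathbb E,\mathfrak s)$ are in the sense of Nakaoka--Palu; an $\mathbb E$-triangle is written $A\to B\to C\dashrightarrow$ and realizes an element of $\mathbb E(C,A)$. $R$-linear means that $\mathcal C$ is $R$-linear and $\mathbb E$ is an $R$-bilinear bifunctor $\mathcal C^{\mathrm{op}}\times\mathcal C\to R\text{-Mod}$. Positive higher extensions (Gorsky--Nakaoka--Palu): $\mathbb E^1=\mathbb E$ and $\mathbb E^i=\mathbb E^{\diamond i}$ is the $i$-fold tensor product of the $\mathcal C$-bimodule $\mathbb E$ over $\mathcal C$, i.e. $\mathbb E^{i}(C,A)=\int^{M\in\mathcal C}\mathbb E^{i-1}(C,M)\otimes_R\mathbb E(M,A)$. It is known that each $\mathbb E$-triangle induces long exact sequences $\mathcal C(X,A)\to\mathcal C(X,B)\to\mathcal C(X,C)\to\mathbb E(X,A)\to\mathbb E(X,B)\to\mathbb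 E(X,C)\to\mathbb E^2(X,A)\to\cdots$ and the contravariant analogue. $\mathbb E^i(\mathcal X,\mathcal X)=0$ means $\mathbb E^i(X,X')=0$ for all $X,X'\in\mathcal X$, and $\mathbb E^i(\mathcal X,\mathcal X)\ne0$ is its negation. For $i\ge1$, ${}^{\perp_i}\mathcal X=\{A\mid \mathbb E^i(A,X)=0\ \forall X\in\mathcal X\}$ and $\mathcal X^{\perp_i}=\{A\mid \mathbb E^i(X,A)=0\ \forall X\in\mathcal X\}$. $\mathcal X=\operatorname{add}\mathcal X$ is two-sided maximally $n$-orthogonal if $\mathcal X=\bigcap_{i=1}^{n}{}^{\perp_i}\mathcal X=\bigcap_{i=1}^{n}\mathcal X^{\perp_i}$. A left $\mathcal X$-approximation of $A$ is a morphism $x_A:A\to X_A$ with $X_A\in\mathcal X$ through which every morphism from $A$ to an object of $\mathcal X$ factors; right approximations are dual. $\mathcal X$ is strongly functorially finite if each $A\in\mathcal C$ admits an $\mathbb E$-triangle $A\xrightarrow{x_A}X_A\to A^+\dashrightarrow$ with $x_A$ a left $\mathcal X$-approximation and an $\mathbb E$-triangle $A^-\to X^A\to A\dashrightarrow$ whose second morphism is a right $\mathcal X$-approximation. $\mathcal C/[\mathcal X]$ is the ideal quotient by the morphisms factoring through objects of $\mathcal X$, with quotient functor $\pi_{\mathcal X}$. The canonical suspension $\Sigma_{\mathcal X}:\mathcal C/[\mathcal X]\to\mathcal C/[\mathcal X]$ is given by $\Sigma_{\mathcal X}(\pi_{\mathcal X}A)=\pi_{\mathcal X}(A^+)$ for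 chosen left approximation $\mathbb E$-triangles; on $f:A\to B$ one completes $f$ to a morphism $(f,g,h)$ of the chosen $\mathbb E$-triangles and sets $\Sigma_{\mathcal X}(\pi_{\mathcal X}f)=\pi_{\mathcal X}h$ (well defined, and independent of choices up to natural isomorphism). The nilpotency index of $\Sigma_{\mathcal X}$ is $\nu_{\mathcal X}(\mathcal C)=\min\{m\ge1\mid\Sigma_{\mathcal X}^m\cong\mathbf 0\}\in\mathbb N\cup\{\infty\}$, where $\mathbf 0$ is the zero endofunctor and $\min\varnothing=\infty$. *)

(* Defs.v *)
From HB Require Import structures.
From mathcomp Require Import all_boot all_order all_algebra.
From mathcomp Require Import boolp.

Set Implicit Arguments.
Unset Strict Implicit.
Unset Printing Implicit Defensive.

Import GRing.Theory.
Local Open Scope ring_scope.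

(* A type whose operations satisfy the module axioms only up to an equivalence
   relation.  Its quotient [pmquot] is an honest [lmodType]; elements of the
   quotient are the equivalence classes.  Both the coends and the Hom-modules
   of ideal quotients below are of this form. *)
Record premodule (R : comPzRingType) := Premodule {
  pm_sort :> Type;
  pm_eqv : pm_sort -> pm_sort -> Prop;
  pm_zero : pm_sort;
  pm_opp : pm_sort -> pm_sort;
  pm_add : pm_sort -> pm_sort -> pm_sort;
  pm_scale : R -> pm_sort -> pm_sort;
  pm_refl : forall s, pm_eqv s s;
  pm_sym : forall s t, pm_eqv s t -> pm_eqv t s;
  pm_trans : forall s t u, pm_eqv s t -> pm_eqv t u -> pm_eqv s u;
  pm_opp_eqv : forall s t, pm_eqv s t -> pm_eqv (pm_opp s) (pm_opp t);
  pm_add_eqv : forall s s' t t', pm_eqv s s' -> pm_eqv t t' ->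
    pm_eqv (pm_add s t) (pm_add s' t');
  pm_scale_eqv : forall r s t, pm_eqv s t ->
    pm_eqv (pm_scale r s) (pm_scale r t);
  pm_addA : forall s t u,
    pm_eqv (pm_add s (pm_add t u)) (pm_add (pm_add s t) u);
  pm_addC : forall s t, pm_eqv (pm_add s t) (pm_add t s);
  pm_add0 : forall s, pm_eqv (pm_add pm_zero s) s;
  pm_addN : forall s, pm_eqv (pm_add (pm_opp s) s) pm_zero;
  pm_scaleA : forall a b s,
    pm_eqv (pm_scale a (pm_scale b s)) (pm_scale (a * b) s);
  pm_scale1 : forall s, pm_eqv (pm_scale 1 s) s;
  pm_scaleDr : forall a s t,
    pm_eqv (pm_scale a (pm_add s t)) (pm_add (pm_scale a s) (pm_scale a t));
  pm_scaleDl : forall a b s,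
    pm_eqv (pm_scale (a + b) s) (pm_add (pm_scale a s) (pm_scale b s))
}.

Definition pmquot (R : comPzRingType) (P : premodule R) : Type :=
  {c : P -> Prop | exists s, c = pm_eqv s}.

Section PMQuot.
Variables (R : comPzRingType) (P : premodule R).

Definition pmpi (s : P) : pmquot P :=
  exist _ (pm_eqv s) (ex_intro _ s erefl).

Lemma pmpiP (s t : P) : pmpi s = pmpi t <-> pm_eqv s t.
Proof.
split=> [/(congr1 sval) /= e|st]; first by rewrite e; apply: pm_refl.
apply: eq_exist; apply/funext => u; apply/propext.
by split; [apply: pm_trans; apply: pm_sym | apply: pm_trans].
Qed.

Lemma pmpi_surj (q : pmquot P) : exists s, pmpi s = q.
Proof. by case: q => c cP; case: (cP) => s es; exists s; apply: eq_exist. Qed.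

Definition pmrepr (q : pmquot P) : P := sval (cid (pmpi_surj q)).

Lemma pmreprK q : pmpi (pmrepr q) = q.
Proof. by rewrite /pmrepr; case: cid. Qed.

Lemma pmrepr_pi s : pm_eqv (pmrepr (pmpi s)) s.
Proof. by apply/pmpiP; rewrite pmreprK. Qed.

HB.instance Definition _ := gen_eqMixin (pmquot P).
HB.instance Definition _ := gen_choiceMixin (pmquot P).

Definition pmq_add (p q : pmquot P) := pmpi (pm_add (pmrepr p) (pmrepr q)).
Definition pmq_opp (p : pmquot P) := pmpi (pm_opp (pmrepr p)).
Definition pmq_scale (r : R) (p : pmquot P) := pmpi (pm_scale r (pmrepr p)).

Lemma pmq_addE s t : pmq_add (pmpi s) (pmpi t) = pmpi (pm_add s t).
Proof. by apply/pmpiP; apply: pm_add_eqv; apply: pmrepr_pi. Qed.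

Lemma pmq_oppE s : pmq_opp (pmpi s) = pmpi (pm_opp s).
Proof. by apply/pmpiP; apply: pm_opp_eqv; apply: pmrepr_pi. Qed.

Lemma pmq_scaleE r s : pmq_scale r (pmpi s) = pmpi (pm_scale r s).
Proof. by apply/pmpiP; apply: pm_scale_eqv; apply: pmrepr_pi. Qed.

Let pmq_addA : associative pmq_add.
Proof.
move=> p q r; rewrite -(pmreprK p) -(pmreprK q) -(pmreprK r) !pmq_addE.
by apply/pmpiP/pm_addA.
Qed.

Let pmq_addC : commutative pmq_add.
Proof.
move=> p q; rewrite -(pmreprK p) -(pmreprK q) !pmq_addE.
by apply/pmpiP/pm_addC.
Qed.

Let pmq_add0 : left_id (pmpi (pm_zero P)) pmq_add.
Proof. by move=> p; rewrite -(pmreprK p) pmq_addE; apply/pmpiP/pm_add0. Qed.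

Let pmq_addN : left_inverse (pmpi (pm_zero P)) pmq_opp pmq_add.
Proof.
by move=> p; rewrite -(pmreprK p) pmq_oppE pmq_addE; apply/pmpiP/pm_addN.
Qed.

HB.instance Definition _ :=
  GRing.isZmodule.Build (pmquot P) pmq_addA pmq_addC pmq_add0 pmq_addN.

Lemma pmpiD s t : pmpi (pm_add s t) = pmpi s + pmpi t.
Proof. by rewrite -pmq_addE. Qed.

Let pmq_scaleA a b p : pmq_scale a (pmq_scale b p) = pmq_scale (a * b) p.
Proof. by rewrite -(pmreprK p) !pmq_scaleE; apply/pmpiP/pm_scaleA. Qed.

Let pmq_scale1 : left_id 1 pmq_scale.
Proof. by move=> p; rewrite -(pmreprK p) pmq_scaleE; apply/pmpiP/pm_scale1. Qed.

Let pmq_scaleDr : right_distributive pmq_scale +%R.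
Proof.
move=> a p q; rewrite -(pmreprK p) -(pmreprK q) -pmpiD !pmq_scaleE -pmpiD.
by apply/pmpiP/pm_scaleDr.
Qed.

Let pmq_scaleDl p : {morph pmq_scale^~ p : a b / a + b}.
Proof.
move=> a b; rewrite -(pmreprK p) !pmq_scaleE -pmpiD.
by apply/pmpiP/pm_scaleDl.
Qed.

HB.instance Definition _ := GRing.Zmodule_isLmodule.Build R (pmquot P)
  pmq_scaleA pmq_scale1 pmq_scaleDr pmq_scaleDl.

Lemma pmpiZ r s : pmpi (pm_scale r s) = r *: pmpi s.
Proof. by rewrite -pmq_scaleE. Qed.

Lemma pmpi0 : pmpi (pm_zero P) = 0. Proof. by []. Qed.

End PMQuot.

Record lincat (R : comPzRingType) := Lincat {
  Ob :> Type;
  Hom : Ob -> Ob -> lmodType R;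
  idm : forall A, Hom A A;
  comp : forall A B D, Hom B D -> Hom A B -> Hom A D;
  compA : forall A B D F (h : Hom D F) (g : Hom B D) (f : Hom A B),
    comp h (comp g f) = comp (comp h g) f;
  comp_idl : forall A B (f : Hom A B), comp (idm B) f = f;
  comp_idr : forall A B (f : Hom A B), comp f (idm A) = f;
  comp_linl : forall A B D (r : R) (g g' : Hom B D) (f : Hom A B),
    comp (r *: g + g') f = r *: comp g f + comp g' f;
  comp_linr : forall A B D (r : R) (g : Hom B D) (f f' : Hom A B),
    comp g (r *: f + f') = r *: comp g f + comp g f';
  zob : Ob;
  zob_initial : forall A (f : Hom zob A), f = 0;
  zob_terminal : forall A (f : Hom A zob), f = 0;
  oplus : Ob -> Ob -> Ob;
  in1 : forall A B, Hom A (oplus A B);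
  in2 : forall A B, Hom B (oplus A B);
  pr1 : forall A B, Hom (oplus A B) A;
  pr2 : forall A B, Hom (oplus A B) B;
  pr1_in1 : forall A B, comp (pr1 A B) (in1 A B) = idm A;
  pr2_in2 : forall A B, comp (pr2 A B) (in2 A B) = idm B;
  pr1_in2 : forall A B, comp (pr1 A B) (in2 A B) = 0;
  pr2_in1 : forall A B, comp (pr2 A B) (in1 A B) = 0;
  oplus_id : forall A B,
    comp (in1 A B) (pr1 A B) + comp (in2 A B) (pr2 A B) = idm (oplus A B)
}.

Arguments Hom {R C} A B : rename.
Arguments idm {R C} A : rename.
Arguments comp {R C A B D} g f : rename.
Arguments zob {R} C : rename.
Arguments oplus {R C} A B : rename.
Arguments in1 {R C} A B : rename.
Arguments in2 {R C} A B : rename.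
Arguments pr1 {R C} A B : rename.
Arguments pr2 {R C} A B : rename.

Declare Scope cat_scope.
Delimit Scope cat_scope with cat.
Local Open Scope cat_scope.
Notation "g ∘ f" := (comp g f) (at level 40, left associativity) : cat_scope.
Notation "A ⊞ B" := (oplus A B) (at level 50, left associativity) : cat_scope.

Section Linear.
Variables (R : comPzRingType) (C : lincat R).
Implicit Types A B D : C.

Lemma compDl A B D (g g' : Hom B D) (f : Hom A B) :
  (g + g') ∘ f = g ∘ f + g' ∘ f.
Proof. by rewrite -[g in LHS]scale1r comp_linl scale1r. Qed.

Lemma compDr A B D (g : Hom B D) (f f' : Hom A B) :
  g ∘ (f + f') = g ∘ f + g ∘ f'.
Proof. by rewrite -[f in LHS]scale1r comp_linr scale1r. Qed.

Lemma comp0l A B D (f : Hom A B) : (0 : Hom B D) ∘ f = 0.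
Proof. by apply: (addrI ((0 : Hom B D) ∘ f)); rewrite -compDl !addr0. Qed.

Lemma comp0r A B D (g : Hom B D) : g ∘ (0 : Hom A B) = 0.
Proof. by apply: (addrI (g ∘ (0 : Hom A B))); rewrite -compDr !addr0. Qed.

Lemma compNl A B D (g : Hom B D) (f : Hom A B) : (- g) ∘ f = - (g ∘ f).
Proof. by apply: (addrI (g ∘ f)); rewrite -compDl !subrr comp0l. Qed.

Lemma compNr A B D (g : Hom B D) (f : Hom A B) : g ∘ (- f) = - (g ∘ f).
Proof. by apply: (addrI (g ∘ f)); rewrite -compDr !subrr comp0r. Qed.

Lemma compBl A B D (g g' : Hom B D) (f : Hom A B) :
  (g - g') ∘ f = g ∘ f - g' ∘ f.
Proof. by rewrite compDl compNl. Qed.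

Lemma compBr A B D (g : Hom B D) (f f' : Hom A B) :
  g ∘ (f - f') = g ∘ f - g ∘ f'.
Proof. by rewrite compDr compNr. Qed.

End Linear.

Definition is_iso (R : comPzRingType) (C : lincat R) (A B : C)
    (f : Hom A B) : Prop :=
  exists g : Hom B A, g ∘ f = idm A /\ f ∘ g = idm B.

Definition is_biproduct (R : comPzRingType) (C : lincat R) (A B P : C)
    (i1 : Hom A P) (i2 : Hom B P) (p1 : Hom P A) (p2 : Hom P B) : Prop :=
  [/\ p1 ∘ i1 = idm A, p2 ∘ i2 = idm B, p1 ∘ i2 = 0, p2 ∘ i1 = 0
    & i1 ∘ p1 + i2 ∘ p2 = idm P].

Definition osum (R : comPzRingType) (C : lincat R) (A A' B B' : C)
    (f : Hom A B) (f' : Hom A' B') : Hom (A ⊞ A') (B ⊞ B') :=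
  in1 B B' ∘ f ∘ pr1 A A' + in2 B B' ∘ f' ∘ pr2 A A'.

Record functor (R : comPzRingType) (C D : lincat R) := Functor {
  fob :> C -> D;
  fmap : forall A B : C, Hom A B -> Hom (fob A) (fob B);
  fmap_id : forall A : C, fmap (idm A) = idm (fob A);
  fmap_comp : forall (A B E : C) (g : Hom B E) (f : Hom A B),
    fmap (g ∘ f) = fmap g ∘ fmap f
}.
Arguments fmap {R C D} F {A B} f : rename.

Section Functors.
Variables (R : comPzRingType) (C : lincat R).

Definition idfun_ : functor C C :=
  @Functor R C C id (fun A B f => f) (fun=> erefl) (fun _ _ _ _ _ => erefl).

Program Definition compfun (G F : functor C C) : functor C C :=
  @Functor R C C (fun A => G (F A)) (fun A B f => fmap G (fmap F f)) _ _.
Next Obligation. by rewrite !fmap_id. Qed.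
Next Obligation. by rewrite !fmap_comp. Qed.

Definition powfun (F : functor C C) (m : nat) : functor C C :=
  iter m (compfun F) idfun_.

Program Definition zerofun : functor C C :=
  @Functor R C C (fun=> zob C) (fun _ _ _ => 0) _ _.
Next Obligation. by rewrite [RHS]zob_initial. Qed.
Next Obligation. by rewrite comp0l. Qed.

Definition natiso (F G : functor C C) : Prop :=
  exists phi : forall A, Hom (F A) (G A),
    (forall A B (f : Hom A B), phi B ∘ fmap F f = fmap G f ∘ phi A)
    /\ (forall A, is_iso (phi A)).

Definition kills (F : functor C C) : pred nat :=
  fun m => (0 < m)%N && `[< natiso (powfun F m) zerofun >].

(* The minimum over m >= 1 with F^m isomorphic to the zero endofunctor;
   [None] stands for infinity. *)
Definition nilpotency_index (F : functor C C) : option nat :=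
  if pselect (exists m, kills F m) is left h then Some (ex_minn h) else None.

End Functors.

(* R-bilinear bifunctors C^op x C -> R-Mod, contravariant in the first and
   covariant in the second argument: [push a x] is a_* x and [pull c x] is
   c^* x. *)
Record bimodule (R : comPzRingType) (C : lincat R) := Bimodule {
  bm :> C -> C -> lmodType R;
  push : forall K A A' : C, Hom A A' -> bm K A -> bm K A';
  pull : forall K K' A : C, Hom K' K -> bm K A -> bm K' A;
  push_id : forall K A (x : bm K A), push (idm A) x = x;
  pull_id : forall K A (x : bm K A), pull (idm K) x = x;
  push_comp : forall K A A' A'' (b : Hom A' A'') (a : Hom A A') (x : bm K A),
    push (b ∘ a) x = push b (push a x);
  pull_comp : forall K K' K'' A (c : Hom K' K) (d : Hom K'' K') (x : bm K A),
    pull (c ∘ d) x = pull d (pull c x);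
  push_pull : forall K K' A A' (a : Hom A A') (c : Hom K' K) (x : bm K A),
    push a (pull c x) = pull c (push a x);
  push_lin : forall K A A' (a : Hom A A') (r : R) (x y : bm K A),
    push a (r *: x + y) = r *: push a x + push a y;
  pull_lin : forall K K' A (c : Hom K' K) (r : R) (x y : bm K A),
    pull c (r *: x + y) = r *: pull c x + pull c y;
  push_linm : forall K A A' (r : R) (a b : Hom A A') (x : bm K A),
    push (r *: a + b) x = r *: push a x + push b x;
  pull_linm : forall K K' A (r : R) (c d : Hom K' K) (x : bm K A),
    pull (r *: c + d) x = r *: pull c x + pull d x
}.
Arguments push {R C E K A A'} a x : rename.
Arguments pull {R C E K K' A} c x : rename.

Section BimoduleTheory.
Variables (R : comPzRingType) (C : lincat R) (E : bimodule C).

Lemma pushD (K A A' : C) (a : Hom A A') (x y : E K A) :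
  push a (x + y) = push a x + push a y.
Proof. by rewrite -[x in LHS]scale1r push_lin scale1r. Qed.

Lemma push0 (K A A' : C) (a : Hom A A') : push a (0 : E K A) = 0.
Proof. by apply: (addrI (push a (0 : E K A))); rewrite -pushD !addr0. Qed.

Lemma pushZ (K A A' : C) (a : Hom A A') r (x : E K A) :
  push a (r *: x) = r *: push a x.
Proof. by rewrite -[r *: x]addr0 push_lin push0 addr0. Qed.

Lemma pullD (K K' A : C) (c : Hom K' K) (x y : E K A) :
  pull c (x + y) = pull c x + pull c y.
Proof. by rewrite -[x in LHS]scale1r pull_lin scale1r. Qed.

Lemma pull0 (K K' A : C) (c : Hom K' K) : pull c (0 : E K A) = 0.
Proof. by apply: (addrI (pull c (0 : E K A))); rewrite -pullD !addr0. Qed.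

Lemma pullZ (K K' A : C) (c : Hom K' K) r (x : E K A) :
  pull c (r *: x) = r *: pull c x.
Proof. by rewrite -[r *: x]addr0 pull_lin pull0 addr0. Qed.

Lemma pushDm (K A A' : C) (a b : Hom A A') (x : E K A) :
  push (a + b) x = push a x + push b x.
Proof. by rewrite -[a in LHS]scale1r push_linm scale1r. Qed.

Lemma push0m (K A A' : C) (x : E K A) : push (0 : Hom A A') x = 0.
Proof. by apply: (addrI (push (0 : Hom A A') x)); rewrite -pushDm !addr0. Qed.

Lemma pushNm (K A A' : C) (a : Hom A A') (x : E K A) :
  push (- a) x = - push a x.
Proof. by apply: (addrI (push a x)); rewrite -pushDm !subrr push0m. Qed.

Lemma pullDm (K K' A : C) (c d : Hom K' K) (x : E K A) :
  pull (c + d) x = pull c x + pull d x.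
Proof. by rewrite -[c in LHS]scale1r pull_linm scale1r. Qed.

Lemma pull0m (K K' A : C) (x : E K A) : pull (0 : Hom K' K) x = 0.
Proof. by apply: (addrI (pull (0 : Hom K' K) x)); rewrite -pullDm !addr0. Qed.

Lemma pullNm (K K' A : C) (c : Hom K' K) (x : E K A) :
  pull (- c) x = - pull c x.
Proof. by apply: (addrI (pull c x)); rewrite -pullDm !subrr pull0m. Qed.

End BimoduleTheory.

Section Tensor.
Variables (R : comPzRingType) (C : lincat R) (F G : bimodule C).

Section At.
Variables (K A : C).

(* A pair (x, y) over M stands for the pure tensor of x : F K M and
   y : G M A; finite sequences of pairs are formal sums. *)
Definition ptens : Type := {M : C & (F K M * G M A)%type}.
Definition Ptens (M : C) (x : F K M) (y : G M A) : ptens := existT _ M (x, y).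

Inductive tens_eqv : seq ptens -> seq ptens -> Prop :=
| te_refl s : tens_eqv s s
| te_sym s t : tens_eqv s t -> tens_eqv t s
| te_trans s t u : tens_eqv s t -> tens_eqv t u -> tens_eqv s u
| te_cat s s' t t' :
    tens_eqv s s' -> tens_eqv t t' -> tens_eqv (s ++ t) (s' ++ t')
| te_comm s t : tens_eqv (s ++ t) (t ++ s)
| te_zero M (y : G M A) : tens_eqv [:: Ptens 0 y] [::]
| te_addl M (x x' : F K M) (y : G M A) :
    tens_eqv [:: Ptens (x + x') y] [:: Ptens x y; Ptens x' y]
| te_addr M (x : F K M) (y y' : G M A) :
    tens_eqv [:: Ptens x (y + y')] [:: Ptens x y; Ptens x y']
| te_scale M (r : R) (x : F K M) (y : G M A) :
    tens_eqv [:: Ptens (r *: x) y] [:: Ptens x (r *: y)]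
| te_bal M M' (m : Hom M M') (x : F K M) (y : G M' A) :
    tens_eqv [:: Ptens (push m x) y] [:: Ptens x (pull m y)].

Definition tens_scale (r : R) : seq ptens -> seq ptens :=
  map (fun p => Ptens (r *: (projT2 p).1) (projT2 p).2).

Lemma tens_scale_eqv r s t :
  tens_eqv s t -> tens_eqv (tens_scale r s) (tens_scale r t).
Proof.
elim=> {s t} [s|s t _|s t u _ IH _|s s' t t' _ IHs _ IHt|s t|M y|M x x' y
  |M x y y'|M a x y|M M' m x y]; rewrite /tens_scale ?map_cat /=.
- exact: te_refl.
- exact: te_sym.
- exact: te_trans IH.
- exact: te_cat.
- exact: te_comm.
- rewrite scaler0; exact: te_zero.
- rewrite scalerDr; exact: te_addl.
- exact: te_addr.
- rewrite scalerA mulrC -scalerA; exact: te_scale.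
- rewrite -pushZ; exact: te_bal.
Qed.

Let te_cons p s s' t :
  tens_eqv [:: p] s' -> tens_eqv s t -> tens_eqv (p :: s) (s' ++ t).
Proof. by move=> ps' st; rewrite -[p :: s]cat1s; apply: te_cat. Qed.

Lemma tens_scaleDl a b s :
  tens_eqv (tens_scale (a + b) s) (tens_scale a s ++ tens_scale b s).
Proof.
elim: s => [|[M [x y]] s IH]; first exact: te_refl.
apply: te_trans (_ : tens_eqv ([:: Ptens (a *: x) y; Ptens (b *: x) y]
  ++ (tens_scale a s ++ tens_scale b s)) _).
  by apply: te_cons IH; rewrite /= scalerDl; apply: te_addl.
apply: (te_cons (s' := [:: _])); first exact: te_refl.
change (tens_eqv ([:: Ptens (b *: x) y] ++ (tens_scale a s ++ tens_scale b s))
  (tens_scale a s ++ ([:: Ptens (b *: x) y] ++ tens_scale b s))).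
rewrite !catA.
by apply: te_cat; [apply: te_comm | apply: te_refl].
Qed.

Lemma tens_scale0 s : tens_eqv (tens_scale 0 s) [::].
Proof.
elim: s => [|[M [x y]] s IH]; first exact: te_refl.
apply: (te_cons (s' := [::])) IH; rewrite /= scale0r; exact: te_zero.
Qed.

Lemma tens_scaleA a b s : tens_scale a (tens_scale b s) = tens_scale (a * b) s.
Proof. by rewrite /tens_scale -map_comp; apply: eq_map => p /=; rewrite scalerA. Qed.

Lemma tens_scale1 s : tens_scale 1 s = s.
Proof.
rewrite -[RHS]map_id; apply: eq_map => -[M [x y]] /=.
by rewrite /Ptens /= scale1r.
Qed.

Lemma tens_scaleDr a s t :
  tens_scale a (s ++ t) = tens_scale a s ++ tens_scale a t.
Proof. exact: map_cat. Qed.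

Program Definition tens_pm : premodule R :=
  @Premodule R (seq ptens) tens_eqv [::] (tens_scale (- 1)) cat tens_scale
    te_refl te_sym te_trans _ te_cat tens_scale_eqv
    _ te_comm te_refl _ _ _ _ tens_scaleDl.
Next Obligation. exact: tens_scale_eqv. Qed.
Next Obligation. rewrite catA; exact: te_refl. Qed.
Next Obligation.
rewrite -{2}[s]tens_scale1; apply: te_trans (te_sym (tens_scaleDl _ _ _)) _.
rewrite addNr; exact: tens_scale0.
Qed.
Next Obligation. rewrite tens_scaleA; exact: te_refl. Qed.
Next Obligation. rewrite tens_scale1; exact: te_refl. Qed.
Next Obligation. rewrite tens_scaleDr; exact: te_refl. Qed.

Definition tens_mod : lmodType R := pmquot tens_pm.

Definition tens (M : C) (x : F K M) (y : G M A) : tens_mod :=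
  @pmpi R tens_pm [:: Ptens x y].

End At.

Lemma tens_map_lin (K A K' A' : C) (g : seq (ptens K A) -> seq (ptens K' A'))
    (g_eqv : forall s t, tens_eqv s t -> tens_eqv (g s) (g t))
    (g_cat : forall s t, g (s ++ t) = g s ++ g t)
    (g_scale : forall r s, g (tens_scale r s) = tens_scale r (g s))
    (h := fun q : tens_mod K A =>
       @pmpi R (tens_pm K' A') (g (pmrepr q)) : tens_mod K' A') :
  (forall s, h (@pmpi R (tens_pm K A) s) = @pmpi R (tens_pm K' A') (g s)) /\
  (forall r p q, h (r *: p + q) = r *: h p + h q).
Proof.
have hE s : h (@pmpi R (tens_pm K A) s) = @pmpi R (tens_pm K' A') (g s).
  by apply/pmpiP; apply: g_eqv; apply: (@pmrepr_pi R (tens_pm K A)).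
split=> // r p q; rewrite -(pmreprK p) -(pmreprK q) -pmpiZ -pmpiD !hE.
by rewrite -pmpiZ -pmpiD /= g_cat g_scale.
Qed.

Definition tens_push1 (K A A' : C) (a : Hom A A') (p : ptens K A) :
    ptens K A' :=
  Ptens (projT2 p).1 (push a (projT2 p).2).
Definition tens_pull1 (K K' A : C) (c : Hom K' K) (p : ptens K A) :
    ptens K' A :=
  Ptens (pull c (projT2 p).1) (projT2 p).2.

Definition tens_push (K A A' : C) (a : Hom A A') (q : tens_mod K A) :
    tens_mod K A' :=
  @pmpi R (tens_pm K A') (map (tens_push1 a) (pmrepr q)).
Definition tens_pull (K K' A : C) (c : Hom K' K) (q : tens_mod K A) :
    tens_mod K' A :=
  @pmpi R (tens_pm K' A) (map (tens_pull1 c) (pmrepr q)).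

Lemma tens_push_eqv (K A A' : C) (a : Hom A A') (s t : seq (ptens K A)) :
  tens_eqv s t -> tens_eqv (map (tens_push1 a) s) (map (tens_push1 a) t).
Proof.
elim=> {s t} [s|s t _|s t u _ IH _|s s' t t' _ IHs _ IHt|s t|M y|M x x' y
  |M x y y'|M r x y|M M' m x y]; rewrite ?map_cat /= /tens_push1 /=.
- exact: te_refl.
- exact: te_sym.
- exact: te_trans IH.
- exact: te_cat.
- exact: te_comm.
- exact: te_zero.
- exact: te_addl.
- rewrite pushD; exact: te_addr.
- rewrite pushZ; exact: te_scale.
- rewrite push_pull; exact: te_bal.
Qed.

Lemma tens_pull_eqv (K K' A : C) (c : Hom K' K) (s t : seq (ptens K A)) :
  tens_eqv s t -> tens_eqv (map (tens_pull1 c) s) (map (tens_pull1 c) t).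
Proof.
elim=> {s t} [s|s t _|s t u _ IH _|s s' t t' _ IHs _ IHt|s t|M y|M x x' y
  |M x y y'|M r x y|M M' m x y]; rewrite ?map_cat /= /tens_pull1 /=.
- exact: te_refl.
- exact: te_sym.
- exact: te_trans IH.
- exact: te_cat.
- exact: te_comm.
- rewrite pull0; exact: te_zero.
- rewrite pullD; exact: te_addl.
- exact: te_addr.
- rewrite pullZ; exact: te_scale.
- rewrite -push_pull; exact: te_bal.
Qed.

Lemma tens_push_spec (K A A' : C) (a : Hom A A') :
  (forall s, tens_push a (@pmpi R (tens_pm K A) s)
     = @pmpi R (tens_pm K A') (map (tens_push1 a) s)) /\
  (forall r p q, tens_push a (r *: p + q) =
     r *: tens_push a p + tens_push (K := K) a q).
Proof.
apply: (tens_map_lin (g := map (tens_push1 a))).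
- exact: tens_push_eqv.
- exact: map_cat.
- by move=> r s; rewrite /tens_scale -!map_comp.
Qed.

Lemma tens_pull_spec (K K' A : C) (c : Hom K' K) :
  (forall s, tens_pull c (@pmpi R (tens_pm K A) s)
     = @pmpi R (tens_pm K' A) (map (tens_pull1 c) s)) /\
  (forall r p q, tens_pull c (r *: p + q) =
     r *: tens_pull c p + tens_pull (A := A) c q).
Proof.
apply: (tens_map_lin (g := map (tens_pull1 c))).
- exact: tens_pull_eqv.
- exact: map_cat.
- move=> r s; rewrite /tens_scale -!map_comp; apply: eq_map => p /=.
  by rewrite /tens_pull1 /= pullZ.
Qed.

Lemma tens_push_tens (K A A' M : C) (a : Hom A A') (x : F K M) (y : G M A) :
  tens_push a (tens x y) = tens x (push a y).
Proof. by case: (tens_push_spec K a) => ->. Qed.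

Lemma tens_pull_tens (K K' A M : C) (c : Hom K' K) (x : F K M) (y : G M A) :
  tens_pull c (tens x y) = tens (pull c x) y.
Proof. by case: (tens_pull_spec A c) => ->. Qed.

Lemma tensD1 (K A M : C) (x x' : F K M) (y : G M A) :
  tens (x + x') y = tens x y + tens x' y.
Proof. by rewrite /tens -pmpiD; apply/pmpiP/te_addl. Qed.

Lemma tensD2 (K A M : C) (x : F K M) (y y' : G M A) :
  tens x (y + y') = tens x y + tens x y'.
Proof. by rewrite /tens -pmpiD; apply/pmpiP/te_addr. Qed.

Lemma tensZ1 (K A M : C) r (x : F K M) (y : G M A) :
  tens (r *: x) y = r *: tens x y.
Proof. by rewrite /tens -pmpiZ. Qed.

Lemma tensZ2 (K A M : C) r (x : F K M) (y : G M A) :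
  tens x (r *: y) = r *: tens x y.
Proof. by rewrite -tensZ1 /tens; apply/esym/pmpiP/te_scale. Qed.

Lemma tens_bal (K A M M' : C) (m : Hom M M') (x : F K M) (y : G M' A) :
  tens (push m x) y = tens x (pull m y).
Proof. by apply/pmpiP/te_bal. Qed.

Lemma tens_pi_cons (K A : C) (p : ptens K A) s :
  @pmpi R (tens_pm K A) (p :: s) =
  tens (projT2 p).1 (projT2 p).2 + @pmpi R (tens_pm K A) s.
Proof. by case: p => M [x y]; rewrite /tens -pmpiD. Qed.

Lemma tens_ind (K A : C) (Q : tens_mod K A -> Prop) :
  Q 0 -> (forall M (x : F K M) (y : G M A) q, Q q -> Q (tens x y + q)) ->
  forall q, Q q.
Proof.
move=> Q0 QD q; case: (pmpi_surj q) => s <-.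
by elim: s => [|p s IH] //; rewrite tens_pi_cons; apply: QD.
Qed.

(* The universal property of the coend of F(K,M) (x)_R G(M,A) over M. *)
Lemma tens_universal (K A : C) (N : lmodType R)
    (phi : forall M : C, F K M -> G M A -> N) :
  (forall M r (x x' : F K M) (y : G M A),
     phi M (r *: x + x') y = r *: phi M x y + phi M x' y) ->
  (forall M r (x : F K M) (y y' : G M A),
     phi M x (r *: y + y') = r *: phi M x y + phi M x y') ->
  (forall M M' (m : Hom M M') (x : F K M) (y : G M' A),
     phi M' (push m x) y = phi M x (pull m y)) ->
  exists! h : tens_mod K A -> N,
    (forall r p q, h (r *: p + q) = r *: h p + h q) /\
    (forall M (x : F K M) (y : G M A), h (tens x y) = phi M x y).
Proof.
move=> linl linr bal.
have linr' M (x : F K M) (y y' : G M A) : phi M x (y + y') = phi M x y + phi M x y'.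
  by rewrite -[y in LHS]scale1r linr scale1r.
have linl' M (x x' : F K M) (y : G M A) : phi M (x + x') y = phi M x y + phi M x' y.
  by rewrite -[x in LHS]scale1r linl scale1r.
have phi0l M (y : G M A) : phi M 0 y = 0.
  by apply: (addrI (phi M 0 y)); rewrite -linl' !addr0.
have phi0r M (x : F K M) : phi M x 0 = 0.
  by apply: (addrI (phi M x 0)); rewrite -linr' !addr0.
pose f (p : ptens K A) := phi _ (projT2 p).1 (projT2 p).2.
pose S (s : seq (ptens K A)) : N := \sum_(p <- s) f p.
have S_eqv s t : tens_eqv s t -> S s = S t.
  elim=> {s t} [s|s t _|s t u _ -> _|s s' t t' _ IHs _ IHt|s t|M y|M x x' y
    |M x y y'|M r x y|M M' m x y] //; rewrite /S ?big_cat ?big_cons ?big_nil /= /f /=.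
  - by rewrite -/(S s) -/(S t) IHs IHt.
  - by rewrite addrC.
  - by rewrite phi0l addr0.
  - by rewrite linl' !addr0.
  - by rewrite linr' !addr0.
  - by rewrite -[r *: x]addr0 -[r *: y]addr0 linl linr phi0l phi0r.
  - by rewrite bal.
pose h (q : tens_mod K A) : N := S (pmrepr q).
have hE s : h (@pmpi R (tens_pm K A) s) = S s.
  by apply: S_eqv; apply: (@pmrepr_pi R (tens_pm K A)).
have SZ r s : S (tens_scale r s) = r *: S s.
  rewrite /S /tens_scale big_map scaler_sumr; apply: eq_bigr => -[M [x y]] _.
  by rewrite /f /= -[r *: x]addr0 linl phi0l addr0.
exists h; split; first split.
- move=> r p q; rewrite -(pmreprK p) -(pmreprK q) -pmpiZ -pmpiD !hE.
  by rewrite -SZ /S big_cat.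
- by move=> M x y; rewrite /tens hE /S big_seq1.
move=> h' [h'lin h't]; apply/funext => q; case: (pmpi_surj q) => s <-.
have h'D p p' : h' (p + p') = h' p + h' p'.
  by rewrite -[p in LHS]scale1r h'lin scale1r.
have h'0 : h' 0 = 0 by apply: (addrI (h' 0)); rewrite -h'D !addr0.
elim: s => [|p s IH]; first by rewrite hE /S big_nil h'0.
by rewrite hE /S big_cons -/(S s) -hE IH tens_pi_cons h'D h't.
Qed.

Program Definition tensor : bimodule C :=
  @Bimodule R C tens_mod tens_push tens_pull _ _ _ _ _ _ _ _ _.
Next Obligation.
elim/tens_ind: x => [|M x y q IH]; first by rewrite -pmpi0 (tens_push_spec _ _).1.
by rewrite -[tens x y]scale1r (tens_push_spec _ _).2 IH tens_push_tens push_id.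
Qed.
Next Obligation.
elim/tens_ind: x => [|M x y q IH]; first by rewrite -pmpi0 (tens_pull_spec _ _).1.
by rewrite -[tens x y]scale1r (tens_pull_spec _ _).2 IH tens_pull_tens pull_id.
Qed.
Next Obligation.
elim/tens_ind: x => [|M x y q IH]; first by rewrite -pmpi0 !(tens_push_spec _ _).1.
rewrite -[tens x y]scale1r !(tens_push_spec _ _).2 IH !tens_push_tens.
by rewrite push_comp.
Qed.
Next Obligation.
elim/tens_ind: x => [|M x y q IH]; first by rewrite -pmpi0 !(tens_pull_spec _ _).1.
rewrite -[tens x y]scale1r !(tens_pull_spec _ _).2 IH !tens_pull_tens.
by rewrite pull_comp.
Qed.
Next Obligation.
elim/tens_ind: x => [|M x y q IH].
  by rewrite -pmpi0 !((tens_pull_spec _ _).1, (tens_push_spec _ _).1).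
rewrite -[tens x y]scale1r !((tens_pull_spec _ _).2, (tens_push_spec _ _).2) IH.
by rewrite !(tens_pull_tens, tens_push_tens).
Qed.
Next Obligation. exact: (tens_push_spec _ _).2. Qed.
Next Obligation. exact: (tens_pull_spec _ _).2. Qed.
Next Obligation.
elim/tens_ind: x => [|M x y q IH].
  by rewrite -pmpi0 !(tens_push_spec _ _).1 pmpi0 scaler0 addr0.
rewrite -[tens x y]scale1r !(tens_push_spec _ _).2 IH !tens_push_tens push_linm.
by rewrite tensD2 tensZ2 !scale1r scalerDr !addrA; congr (_ + _); rewrite addrAC.
Qed.
Next Obligation.
elim/tens_ind: x => [|M x y q IH].
  by rewrite -pmpi0 !(tens_pull_spec _ _).1 pmpi0 scaler0 addr0.
rewrite -[tens x y]scale1r !(tens_pull_spec _ _).2 IH !tens_pull_tens pull_linm.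
by rewrite tensD1 tensZ1 !scale1r scalerDr !addrA; congr (_ + _); rewrite addrAC.
Qed.

End Tensor.

(* The higher extension bimodule E^i for i >= 1; the value at i = 0 is
   meaningless (it is E again) and never used. *)
Definition Ext (R : comPzRingType) (C : lincat R) (E : bimodule C) (i : nat) :
    bimodule C :=
  iter i.-1 (fun F => tensor F E) E.

Definition esum (R : comPzRingType) (C : lincat R) (E : bimodule C)
    (K K' A A' : C) (d : E K A) (d' : E K' A') : E (K ⊞ K') (A ⊞ A') :=
  push (in1 A A') (pull (pr1 K K') d) + push (in2 A A') (pull (pr2 K K') d').

Definition seq_equiv (R : comPzRingType) (C : lincat R) (A B B' K : C)
    (x : Hom A B) (y : Hom B K) (x' : Hom A B') (y' : Hom B' K) : Prop :=
  exists b : Hom B B', [/\ is_iso b, b ∘ x = x' & y' ∘ b = y].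

(* [rlz x y d] says that the sequence A -x-> B -y-> K belongs to the
   equivalence class s(d), i.e. that A -> B -> K -d-> is an E-triangle.
   [rlz_ex] and [rlz_class] say that s(d) is exactly one equivalence class. *)
Record extriangulation (R : comPzRingType) (C : lincat R) := Extriangulation {
  EE :> bimodule C;
  rlz : forall A B K : C, Hom A B -> Hom B K -> EE K A -> Prop;
  rlz_ex : forall (A K : C) (d : EE K A),
    exists (B : C) (x : Hom A B) (y : Hom B K), rlz x y d;
  rlz_class : forall (A K : C) (d : EE K A) (B B' : C) (x : Hom A B)
      (y : Hom B K) (x' : Hom A B') (y' : Hom B' K),
    rlz x y d -> (rlz x' y' d <-> seq_equiv x y x' y');
  rlz_mor : forall (A B K A' B' K' : C) (x : Hom A B) (y : Hom B K)
      (d : EE K A) (x' : Hom A' B') (y' : Hom B' K') (d' : EE K' A')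
      (a : Hom A A') (c : Hom K K'),
    rlz x y d -> rlz x' y' d' -> push a d = pull c d' ->
    exists b : Hom B B', b ∘ x = x' ∘ a /\ y' ∘ b = c ∘ y;
  rlz_split : forall A K : C, rlz (in1 A K) (pr2 A K) (0 : EE K A);
  rlz_sum : forall (A B K A' B' K' : C) (x : Hom A B) (y : Hom B K)
      (d : EE K A) (x' : Hom A' B') (y' : Hom B' K') (d' : EE K' A'),
    rlz x y d -> rlz x' y' d' -> rlz (osum x x') (osum y y') (esum d d');
  ET3 : forall (A B K A' B' K' : C) (x : Hom A B) (y : Hom B K)
      (d : EE K A) (x' : Hom A' B') (y' : Hom B' K') (d' : EE K' A')
      (a : Hom A A') (b : Hom B B'),
    rlz x y d -> rlz x' y' d' -> b ∘ x = x' ∘ a ->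
    exists c : Hom K K', push a d = pull c d' /\ c ∘ y = y' ∘ b;
  ET3op : forall (A B K A' B' K' : C) (x : Hom A B) (y : Hom B K)
      (d : EE K A) (x' : Hom A' B') (y' : Hom B' K') (d' : EE K' A')
      (b : Hom B B') (c : Hom K K'),
    rlz x y d -> rlz x' y' d' -> y' ∘ b = c ∘ y ->
    exists a : Hom A A', push a d = pull c d' /\ x' ∘ a = b ∘ x;
  ET4 : forall (A B D F K : C) (f : Hom A B) (f' : Hom B D) (d : EE D A)
      (g : Hom B K) (g' : Hom K F) (d' : EE F B),
    rlz f f' d -> rlz g g' d' ->
    exists (E : C) (h : Hom A K) (h' : Hom K E) (k : Hom D E) (e : Hom E F)
      (d'' : EE E A),
      [/\ h = g ∘ f, h' ∘ g = k ∘ f' & e ∘ h' = g'] /\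
      [/\ rlz h h' d'', rlz k e (push f' d'), pull k d'' = d
        & push f d'' = pull e d'];
  ET4op : forall (A B D F K : C) (f' : Hom D A) (f : Hom A B) (d : EE B D)
      (g' : Hom F B) (g : Hom B K) (d' : EE K F),
    rlz f' f d -> rlz g' g d' ->
    exists (E : C) (h' : Hom E A) (h : Hom A K) (k : Hom D E) (e : Hom E F)
      (d'' : EE K E),
      [/\ h = g ∘ f, h' ∘ k = f' & f ∘ h' = g' ∘ e] /\
      [/\ rlz h' h d'', rlz k e (pull g' d), push e d'' = d'
        & push k d = pull g d'']
}.
Arguments rlz {R C} S {A B K} x y d : rename.

Definition nonsplit (R : comPzRingType) (C : lincat R)
    (S : extriangulation C) : Prop :=
  exists (K A : C) (d : S K A), d <> 0.

(* Full subcategories X with X = add X. *)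
Record addsubcat (R : comPzRingType) (C : lincat R) := Addsubcat {
  mem_sub :> C -> Prop;
  sub_iso : forall (A B : C) (f : Hom A B), is_iso f -> mem_sub A -> mem_sub B;
  sub_zero : mem_sub (zob C);
  sub_oplus : forall A B : C, mem_sub A -> mem_sub B -> mem_sub (A ⊞ B);
  sub_summand : forall (A B P : C) (i1 : Hom A P) (i2 : Hom B P)
      (p1 : Hom P A) (p2 : Hom P B),
    is_biproduct i1 i2 p1 p2 -> mem_sub P -> mem_sub A
}.

Section Subcategories.
Variables (R : comPzRingType) (C : lincat R) (S : extriangulation C).

Definition Ext_vanish (i : nat) (X Y : C -> Prop) : Prop :=
  forall A B : C, X A -> Y B -> forall e : Ext S i A B, e = 0.

Definition left_perp (i : nat) (X : C -> Prop) (A : C) : Prop :=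
  forall B : C, X B -> forall e : Ext S i A B, e = 0.

Definition right_perp (i : nat) (X : C -> Prop) (A : C) : Prop :=
  forall B : C, X B -> forall e : Ext S i B A, e = 0.

Definition max_orthogonal (n : nat) (X : addsubcat C) : Prop :=
  (forall A : C, X A <-> forall i, (1 <= i <= n)%N -> left_perp i X A) /\
  (forall A : C, X A <-> forall i, (1 <= i <= n)%N -> right_perp i X A).

Definition left_approx (X : C -> Prop) (A X_A : C) (x : Hom A X_A) : Prop :=
  X X_A /\ forall (B : C) (f : Hom A B), X B -> exists g, f = g ∘ x.

Definition right_approx (X : C -> Prop) (A X_A : C) (x : Hom X_A A) : Prop :=
  X X_A /\ forall (B : C) (f : Hom B A), X B -> exists g, f = x ∘ g.

(* E-triangles A -> X_A -> A^+ and A^- -> X^A -> A. *)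
Record left_triangle (X : C -> Prop) (A : C) := LeftTriangle {
  lt_mid : C;
  lt_plus : C;
  lt_in : Hom A lt_mid;
  lt_out : Hom lt_mid lt_plus;
  lt_ext : S lt_plus A;
  lt_rlz : rlz S lt_in lt_out lt_ext;
  lt_approx : left_approx X lt_in
}.

Record right_triangle (X : C -> Prop) (A : C) := RightTriangle {
  rt_minus : C;
  rt_mid : C;
  rt_in : Hom rt_minus rt_mid;
  rt_out : Hom rt_mid A;
  rt_ext : S A rt_minus;
  rt_rlz : rlz S rt_in rt_out rt_ext;
  rt_approx : right_approx X rt_out
}.

Definition strongly_functorially_finite (X : C -> Prop) : Prop :=
  forall A : C, inhabited (left_triangle X A) /\ inhabited (right_triangle X A).

End Subcategories.

Section IdealQuotient.
Variables (R : comPzRingType) (C : lincat R) (X : addsubcat C).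

Definition factors (A B : C) (f : Hom A B) : Prop :=
  exists (Z : C) (u : Hom A Z) (v : Hom Z B), X Z /\ f = v ∘ u.

Lemma factors0 (A B : C) : factors (0 : Hom A B).
Proof.
exists (zob C), 0, 0; split; first exact: sub_zero.
by rewrite comp0l.
Qed.

Lemma factors_lin (A B : C) r (f g : Hom A B) :
  factors f -> factors g -> factors (r *: f + g).
Proof.
case=> [Z [u [v [XZ ->]]]] [Z' [u' [v' [XZ' ->]]]].
exists (Z ⊞ Z'), (in1 Z Z' ∘ u + in2 Z Z' ∘ u'),
  (r *: (v ∘ pr1 Z Z') + v' ∘ pr2 Z Z'); split; first exact: sub_oplus.
have e1 : pr1 Z Z' ∘ (in1 Z Z' ∘ u + in2 Z Z' ∘ u') = u.
  by rewrite compDr !compA pr1_in1 pr1_in2 comp0l comp_idl addr0.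
have e2 : pr2 Z Z' ∘ (in1 Z Z' ∘ u + in2 Z Z' ∘ u') = u'.
  by rewrite compDr !compA pr2_in2 pr2_in1 comp0l comp_idl add0r.
by rewrite comp_linl -!compA e1 e2.
Qed.

Lemma factorsN (A B : C) (f : Hom A B) : factors f -> factors (- f).
Proof.
by move=> Xf; rewrite -[- f]addr0 -scaleN1r; apply: factors_lin => //;
  apply: factors0.
Qed.

Lemma factorsD (A B : C) (f g : Hom A B) :
  factors f -> factors g -> factors (f + g).
Proof. by move=> Xf Xg; rewrite -[f]scale1r; apply: factors_lin. Qed.

Lemma factors_comp (A B D E : C) (h : Hom D E) (g : Hom B D) (f : Hom A B) :
  factors g -> factors (h ∘ g ∘ f).
Proof.
case=> [Z [u [v [XZ ->]]]]; exists Z, (u ∘ f), (h ∘ v).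
by split=> //; rewrite !compA.
Qed.

Lemma factors_compl (B D E : C) (h : Hom D E) (g : Hom B D) :
  factors g -> factors (h ∘ g).
Proof. by move/(factors_comp h (idm B)); rewrite comp_idr. Qed.

Lemma factors_compr (A B D : C) (g : Hom B D) (f : Hom A B) :
  factors g -> factors (g ∘ f).
Proof. by move/(factors_comp (idm D) f); rewrite comp_idl. Qed.

Definition ideal_eqv (A B : C) (f g : Hom A B) : Prop := factors (f - g).

Lemma ideal_eqv_eq (A B : C) (f g : Hom A B) : f = g -> ideal_eqv f g.
Proof. by move->; rewrite /ideal_eqv subrr; apply: factors0. Qed.

Program Definition ideal_pm (A B : C) : premodule R :=
  @Premodule R (Hom A B) (@ideal_eqv A B) 0 -%R +%R *:%R
    _ _ _ _ _ _ _ _ _ _ _ _ _ _.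
Next Obligation. exact: ideal_eqv_eq. Qed.
Next Obligation. by rewrite /ideal_eqv -opprB; apply: factorsN. Qed.
Next Obligation.
rewrite /ideal_eqv (_ : s - u = (s - t) + (t - u)); first exact: factorsD.
by rewrite addrA subrK.
Qed.
Next Obligation. by rewrite /ideal_eqv -opprD; apply: factorsN. Qed.
Next Obligation.
by rewrite /ideal_eqv opprD addrACA; apply: factorsD.
Qed.
Next Obligation.
rewrite /ideal_eqv -scalerBr -[_ *: _]addr0; apply: factors_lin => //.
exact: factors0.
Qed.
Next Obligation. by apply: ideal_eqv_eq; rewrite addrA. Qed.
Next Obligation. by apply: ideal_eqv_eq; rewrite addrC. Qed.
Next Obligation. by apply: ideal_eqv_eq; rewrite add0r. Qed.
Next Obligation. by apply: ideal_eqv_eq; rewrite addNr. Qed.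
Next Obligation. by apply: ideal_eqv_eq; rewrite scalerA. Qed.
Next Obligation. by apply: ideal_eqv_eq; rewrite scale1r. Qed.
Next Obligation. by apply: ideal_eqv_eq; rewrite scalerDr. Qed.
Next Obligation. by apply: ideal_eqv_eq; rewrite scalerDl. Qed.

Definition qHom (A B : C) : lmodType R := pmquot (ideal_pm A B).
Definition qpi (A B : C) (f : Hom A B) : qHom A B := @pmpi R (ideal_pm A B) f.
Definition qrepr (A B : C) (f : qHom A B) : Hom A B :=
  @pmrepr R (ideal_pm A B) f.

Definition qcomp (A B D : C) (g : qHom B D) (f : qHom A B) : qHom A D :=
  qpi (qrepr g ∘ qrepr f).

Lemma qpiP (A B : C) (f g : Hom A B) : qpi f = qpi g <-> factors (f - g).
Proof. exact: pmpiP. Qed.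

Lemma qreprK (A B : C) (f : qHom A B) : qpi (qrepr f) = f.
Proof. exact: pmreprK. Qed.

Lemma qpi_lin (A B : C) r (f g : Hom A B) :
  qpi (r *: f + g) = r *: qpi f + qpi g.
Proof. by rewrite /qpi -pmpiZ -pmpiD. Qed.

Lemma qcompE (A B D : C) (g : Hom B D) (f : Hom A B) :
  qcomp (qpi g) (qpi f) = qpi (g ∘ f).
Proof.
apply/qpiP.
have /qpiP Xg := qreprK (qpi g); have /qpiP Xf := qreprK (qpi f).
rewrite -(subrK (g ∘ qrepr (qpi f)) (qrepr (qpi g) ∘ _)) -compBl -addrA -compBr.
by apply: factorsD; [apply: factors_compr | apply: factors_compl].
Qed.

Program Definition ideal_quotient : lincat R :=
  @Lincat R C qHom (fun A => qpi (idm A)) qcomp _ _ _ _ _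
    (zob C) _ _ oplus
    (fun A B => qpi (in1 A B)) (fun A B => qpi (in2 A B))
    (fun A B => qpi (pr1 A B)) (fun A B => qpi (pr2 A B)) _ _ _ _ _.
Next Obligation.
by rewrite -(qreprK h) -(qreprK g) -(qreprK f) !qcompE compA.
Qed.
Next Obligation. by rewrite -(qreprK f) qcompE comp_idl. Qed.
Next Obligation. by rewrite -(qreprK f) qcompE comp_idr. Qed.
Next Obligation.
rewrite -(qreprK g) -(qreprK g') -(qreprK f) -qpi_lin !qcompE -qpi_lin.
by rewrite comp_linl.
Qed.
Next Obligation.
rewrite -(qreprK g) -(qreprK f') -(qreprK f) -qpi_lin !qcompE -qpi_lin.
by rewrite comp_linr.
Qed.
Next Obligation. by rewrite -(qreprK f) [qrepr f]zob_initial. Qed.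
Next Obligation. by rewrite -(qreprK f) [qrepr f]zob_terminal. Qed.
Next Obligation. by rewrite qcompE pr1_in1. Qed.
Next Obligation. by rewrite qcompE pr2_in2. Qed.
Next Obligation. by rewrite qcompE pr1_in2. Qed.
Next Obligation. by rewrite qcompE pr2_in1. Qed.
Next Obligation.
by rewrite !qcompE -[qpi (_ ∘ pr1 _ _)]scale1r -qpi_lin scale1r oplus_id.
Qed.

Definition quotient_functor : functor C ideal_quotient :=
  @Functor R C ideal_quotient (fun A => A) (@qpi)
    (fun=> erefl) (fun A B D g f => esym (qcompE g f)).

End IdealQuotient.

Section Suspension.
Variables (R : comPzRingType) (C : lincat R) (S : extriangulation C).
Variables (X : addsubcat C) (T : forall A : C, left_triangle S X A).

Definition tri_mor (A B : C) (f : Hom A B)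
    (g : Hom (lt_mid (T A)) (lt_mid (T B)))
    (h : Hom (lt_plus (T A)) (lt_plus (T B))) : Prop :=
  [/\ g ∘ lt_in (T A) = lt_in (T B) ∘ f,
      h ∘ lt_out (T A) = lt_out (T B) ∘ g
    & push f (lt_ext (T A)) = pull h (lt_ext (T B))].

Lemma tri_mor_ex (A B : C) (f : Hom A B) : exists h g, tri_mor f g h.
Proof.
have [XA fac] := lt_approx (T A).
have [g eg] := fac _ (lt_in (T B) ∘ f) (lt_approx (T B)).1.
have [h [e1 e2]] := ET3 (lt_rlz (T A)) (lt_rlz (T B)) (esym eg).
by exists h, g.
Qed.

Lemma rlz_push0 (A B K : C) (x : Hom A B) (y : Hom B K) (d : S K A) :
  rlz S x y d -> push x d = 0.
Proof.
move=> rd.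
have [c [-> _]] := ET3 rd (rlz_split S B (zob C)) (erefl (in1 B (zob C) ∘ x)).
exact: pull0.
Qed.

Lemma rlz_lift (A B K D : C) (x : Hom A B) (y : Hom B K) (d : S K A)
    (h : Hom D K) : rlz S x y d -> pull h d = 0 -> exists k, h = y ∘ k.
Proof.
move=> rd hd0.
have e : push (0 : Hom (zob C) A) (0 : S D (zob C)) = pull h d.
  by rewrite push0 hd0.
have [b [_ eb]] := rlz_mor (rlz_split S (zob C) D) rd e.
exists (b ∘ in2 (zob C) D).
by rewrite compA eb -compA pr2_in2 comp_idr.
Qed.

Lemma tri_mor_factors (A B : C) (f f' : Hom A B) g g' h h' :
  tri_mor f g h -> tri_mor f' g' h' -> factors X (f - f') ->
  factors X (h - h').
Proof.
case=> _ _ e1 [_ _ e1'] [Z [u [v [XZ ef]]]].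
have [k ek] : exists k, h - h' = lt_out (T B) ∘ k.
  apply: rlz_lift (lt_rlz (T B)) _.
  rewrite pullDm pullNm -e1 -e1' -pushNm -pushDm ef.
  have [w ->] := (lt_approx (T A)).2 _ u XZ.
  by rewrite !push_comp (rlz_push0 (lt_rlz (T A))) !push0.
by exists (lt_mid (T B)), k, (lt_out (T B)); split=> //; apply: (lt_approx (T B)).1.
Qed.

Definition susp_ob (A : ideal_quotient X) : ideal_quotient X := lt_plus (T A).

(* Choose a representative of f and a third component h completing it to a
   morphism of the chosen triangles; by [susp_mapE] any choice of both gives
   the same class. *)
Definition susp_map (A B : ideal_quotient X) (f : Hom A B) :
    Hom (susp_ob A) (susp_ob B) :=
  qpi X (sval (cid (tri_mor_ex (qrepr f)))).

Lemma susp_mapE (A B : C) (f : Hom A B) g h :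
  tri_mor f g h -> susp_map (A := A) (B := B) (qpi X f) = qpi X h.
Proof.
move=> tm; apply/qpiP; case: cid => h' [g' tm'] /=.
by apply: (tri_mor_factors tm' tm); apply/qpiP; rewrite qreprK.
Qed.

Program Definition suspension : functor (ideal_quotient X) (ideal_quotient X) :=
  @Functor R (ideal_quotient X) (ideal_quotient X) susp_ob susp_map _ _.
Next Obligation.
apply: (susp_mapE (g := idm _)); split; rewrite ?comp_idl ?comp_idr //.
by rewrite push_id pull_id.
Qed.
Next Obligation.
rewrite -(qreprK g) -(qreprK f).
have [h1 [g1 tm1]] := tri_mor_ex (qrepr f).
have [h2 [g2 tm2]] := tri_mor_ex (qrepr g).
rewrite [in LHS]/= qcompE (susp_mapE tm1) (susp_mapE tm2) [RHS]/= qcompE.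
apply: (susp_mapE (g := g2 ∘ g1)).
case: tm1 tm2 => [a1 b1 c1] [a2 b2 c2]; split.
- by rewrite -compA a1 compA a2 compA.
- by rewrite compA -b2 -!compA b1.
- by rewrite push_comp c1 push_pull c2 pull_comp.
Qed.

End Suspension.

(* Main.v *)
From mathcomp Require Import all_boot all_algebra.
From mathcomp Require Import boolp.
Require Import Defs.

(** Write A -> X_A -> A^+ and A^- -> X^A -> A for the E-triangles given by left
and right approximations, and call A^+ the cosyzygy and A^- the syzygy of A.

Everything is read off from syzygies, through one family of exact sequences:
for an E-triangle A -> B -> K realizing d,
  E^i(D,A) -> E^i(D,B) -> E^i(D,K) -> E^(i+1)(D,A) -> E^(i+1)(D,B),
where the connecting map sends z to the pure tensor of z and d.

Apply them to A^- -> X^A -> A and D in X.  As E^i(X,X) = 0 for 1 <= i <= n, the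
group E^(i+1)(D,A^-) vanishes as soon as E^i(D,A) does ([ExtS_syzygy], i < n),
and E^i(D,A) vanishes as soon as E^(i+1)(D,A^-) does ([Ext_of_syzygy], i <= n).
- Since E^1(X,A^-) = 0 because the deflation is a right approximation, the
  first implication shows that the n-th syzygy of every object is right
  orthogonal to X in degrees 1 to n, hence lies in X.
- Suppose E^(k+1)(X,-) kills the k-th syzygy of every object, for one k <= n.
  The second implication gives E(X,-) = 0, whence E^i(X,-) = 0 for all i since
  E^i is an iterated tensor product; then every object is in X and E = 0.
  So this never happens when E is nonzero ([nonsplit_syzygy]).
If E^(n+1)(X,X) were zero, the second item would fail for k = n.  If all k-th
syzygies were in X for some k < n, it would fail for that k.  So E^(n+1)(X,X)
is nonzero, and n is the least k for which all k-th syzygies lie in X.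

It remains to pass from syzygies to the suspension, which is built from
cosyzygies.  The functor A |-> A^+ on the ideal quotient is left adjoint to
A |-> A^-.  Only the vanishing half of the adjunction matters: all maps
A^+ -> B factor through X iff all maps A -> B^- do
([factors_cosyzygy_syzygy]).  Iterating, and testing an object of the quotient
for being zero on its outgoing or on its incoming maps, the m-th cosyzygies all
lie in X iff the m-th syzygies do ([iter_cosyzygyP]).

The exact sequences rest on knowing when a pure tensor over C vanishes
([tens_eq0_push_annihilated]): the tensor of x : F K M and th : G M A is zero
only if th is pulled back from some th' along a map m for which m_* x is pushed
forward along a map killing th'.  The proof follows the generating relations of
the tensor product; it exploits that elements of G(-,A) form a directed system
under pullback, because C has biproducts.  When F is half exact, a homotopy
pullback moves the conclusion back to x itself ([tens_eq0_annihilated]). *)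

Set Implicit Arguments.
Unset Strict Implicit.
Unset Printing Implicit Defensive.

Import GRing.Theory.
Local Open Scope ring_scope.
Local Open Scope cat_scope.

(** * Biproducts *)

Section BiproductCalculus.
Variables (R : comPzRingType) (C : lincat R).

Lemma pr1_in1K (A B D : C) (f : Hom D A) : pr1 A B ∘ (in1 A B ∘ f) = f.
Proof. by rewrite compA pr1_in1 comp_idl. Qed.

Lemma pr2_in2K (A B D : C) (f : Hom D B) : pr2 A B ∘ (in2 A B ∘ f) = f.
Proof. by rewrite compA pr2_in2 comp_idl. Qed.

Lemma pr1_in2_0 (A B D : C) (f : Hom D B) : pr1 A B ∘ (in2 A B ∘ f) = 0.
Proof. by rewrite compA pr1_in2 comp0l. Qed.

Lemma pr2_in1_0 (A B D : C) (f : Hom D A) : pr2 A B ∘ (in1 A B ∘ f) = 0.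
Proof. by rewrite compA pr2_in1 comp0l. Qed.

Lemma compAr (A B D E : C) (h : Hom D E) (g : Hom B D) (f : Hom A B) :
  h ∘ g ∘ f = h ∘ (g ∘ f).
Proof. by rewrite compA. Qed.

(** Normalizes composites of structure maps of biproducts; composites are
    reassociated to the right so that a projection meets the injection. *)
Definition biprodE :=
  (compAr, compDl, compDr, compNl, compNr,
   pr1_in1K, pr2_in2K, pr1_in2_0, pr2_in1_0,
   @pr1_in1 R C, @pr2_in2 R C, @pr1_in2 R C, @pr2_in1 R C, comp0l, comp0r,
   @comp_idl R C, @comp_idr R C, @addr0, @add0r, @oppr0).

End BiproductCalculus.

Section Biproducts.
Variables (R : comPzRingType) (C : lincat R) (F : bimodule C).

Lemma push_copair (K A B D : C) (f : Hom A D) (g : Hom B D)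
    (u : F K A) (v : F K B) :
  push (f ∘ pr1 A B + g ∘ pr2 A B) (push (in1 A B) u + push (in2 A B) v)
  = push f u + push g v.
Proof.
by rewrite pushD -!push_comp !biprodE.
Qed.

Lemma pull_in1 (K K' A : C) (x : F K A) (y : F K' A) :
  pull (in1 K K') (pull (pr1 K K') x + pull (pr2 K K') y) = x.
Proof.
by rewrite pullD -!pull_comp pr1_in1 pr2_in1 pull_id pull0m addr0.
Qed.

Lemma pull_in2 (K K' A : C) (x : F K A) (y : F K' A) :
  pull (in2 K K') (pull (pr1 K K') x + pull (pr2 K K') y) = y.
Proof.
by rewrite pullD -!pull_comp pr1_in2 pr2_in2 pull_id pull0m add0r.
Qed.

End Biproducts.

(** * Vanishing of pure tensors *)

Section TensorKernel.
Variables (R : comPzRingType) (C : lincat R) (F G : bimodule C).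
Variables (K A : C).

(** The evident reason for the tensor of [w] and [th] to vanish: [w] comes from
    an object along a map that kills [th]. *)
Definition annihilated (M : C) (th : G M A) (w : F K M) : Prop :=
  exists (P : C) (p : Hom P M) (v : F K P), pull p th = 0 /\ w = push p v.

Lemma annihilated0 M (th : G M A) : annihilated th 0.
Proof. by exists M, 0, 0; rewrite pull0m push0. Qed.

Lemma annihilatedD M (th : G M A) w w' :
  annihilated th w -> annihilated th w' -> annihilated th (w + w').
Proof.
case=> [P [p [v [p0 ->]]]] [P' [p' [v' [p'0 ->]]]].
exists (P ⊞ P'), (p ∘ pr1 P P' + p' ∘ pr2 P P'),
  (push (in1 P P') v + push (in2 P P') v').
by rewrite push_copair pullDm !pull_comp p0 p'0 !pull0 addr0.
Qed.

Lemma annihilatedN M (th : G M A) w :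
  annihilated th w -> annihilated th (- w).
Proof.
case=> [P [p [v [p0 ->]]]]; exists P, (- p), v.
by rewrite pullNm pushNm p0 oppr0.
Qed.

Lemma annihilated_push M M' (th : G M A) (th' : G M' A) (m : Hom M M') w :
  pull m th' = th -> annihilated th w -> annihilated th' (push m w).
Proof.
move=> <- [P [p [v [p0 ->]]]]; exists P, (m ∘ p), v.
by rewrite pull_comp push_comp.
Qed.

(** Two maps pulling [th] back to the same class need not agree, but their
    difference kills [th]; so they induce the same map modulo annihilated
    elements. *)
Lemma annihilated_eq M M' (th : G M' A) (m m' : Hom M M') (x : F K M) :
  pull m th = pull m' th -> annihilated th (push m x - push m' x).
Proof.
move=> e; exists M, (m - m'), x.
by rewrite pullDm pullNm pushDm pushNm e subrr.
Qed.

(** The tensor product is the directed colimit, over the classes [th : G M A]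
    ordered by pullback, of the quotients of F(K,M) by annihilated elements.
    [value s th u] says that [u] represents the formal sum [s] at stage [th].
    It is a relation because the maps to the stage are not unique. *)
Fixpoint value (s : seq (ptens F G K A)) (M : C) (th : G M A) (u : F K M) :
    Prop :=
  if s is p :: s' then
    exists (m : Hom (projT1 p) M) (u' : F K M),
      [/\ pull m th = (projT2 p).2, value s' th u'
        & u = push m (projT2 p).1 + u']
  else u = 0.

Lemma value1 M M' (x : F K M) (th : G M A) (th' : G M' A) (m : Hom M M') :
  pull m th' = th -> value [:: Ptens x th] th' (push m x).
Proof. by move=> e; exists m, 0; rewrite addr0. Qed.

Lemma value_cat s t M (th : G M A) u v :
  value s th u -> value t th v -> value (s ++ t) th (u + v).
Proof.
elim: s u => [|p s IH] u /=; first by move=> ->; rewrite add0r.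
case=> [m [u' [e su ->]]] tv; exists m, (u' + v); rewrite addrA.
by split=> //; apply: IH.
Qed.

Lemma value_push s M M' (th : G M A) (th' : G M' A) (g : Hom M M') u :
  pull g th' = th -> value s th u -> value s th' (push g u).
Proof.
move=> <-; elim: s u => [|p s IH] u /=; first by move=> ->; rewrite push0.
case=> [m [u' [e su ->]]]; exists (g ∘ m), (push g u').
by rewrite pull_comp push_comp pushD; split=> //; apply: IH.
Qed.

Lemma value_uniq s M (th : G M A) u v :
  value s th u -> value s th v -> annihilated th (u - v).
Proof.
elim: s u v => [|p s IH] u v /=.
  by move=> -> ->; rewrite subrr; apply: annihilated0.
case=> [m [u' [e su ->]]] [m' [v' [e' sv ->]]].
rewrite opprD addrACA; apply: annihilatedD; last exact: IH.
by apply: annihilated_eq; rewrite e e'.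
Qed.

(** Equality in the colimit; it contains all relations defining the tensor
    product ([tens_eqv_same_value]). *)
Definition same_value (s t : seq (ptens F G K A)) : Prop :=
  exists (M : C) (th : G M A) (u v : F K M),
    [/\ value s th u, value t th v & annihilated th (u - v)].

Lemma same_valueI s t M (th : G M A) u :
  value s th u -> value t th u -> same_value s t.
Proof.
move=> su tu; exists M, th, u, u; split=> //.
by rewrite subrr; apply: annihilated0.
Qed.

Lemma value_ex s : exists (M : C) (th : G M A) (u : F K M), value s th u.
Proof.
elim: s => [|[M [x y]] s [M' [th' [u su]]]]; first by exists (zob C), 0, 0.
exists (M ⊞ M'), (pull (pr1 M M') y + pull (pr2 M M') th'),
  (push (in1 M M') x + push (in2 M M') u), (in1 M M'), (push (in2 M M') u).
split=> //=; first exact: pull_in1.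
by apply: value_push su; apply: pull_in2.
Qed.

(** The order on classes by pullback is directed. *)
Lemma join_ex M M' (th : G M A) (th' : G M' A) :
  exists (N : C) (ps : G N A) (m : Hom M N) (m' : Hom M' N),
    pull m ps = th /\ pull m' ps = th'.
Proof.
exists (M ⊞ M'), (pull (pr1 M M') th + pull (pr2 M M') th'),
  (in1 M M'), (in2 M M').
by rewrite pull_in1 pull_in2.
Qed.

(** Transitivity and concatenation compare values taken at different stages, so
    both are first moved to a common one. *)
Lemma tens_eqv_same_value s t : tens_eqv s t -> same_value s t.
Proof.
elim=> {s t} [s|s t _|s t w _ st _ tw|s s' t t' _ ss' _ tt'|s t|M y|M x x' y
  |M x y y'|M r x y|M M' m x y].
- by have [M [th [u su]]] := value_ex s; exact: (same_valueI su su).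
- case=> [M [th [u [v [su tv a]]]]]; exists M, th, v, u; split=> //.
  by rewrite -opprB; apply: annihilatedN.
- case: st => [M [th [u [v [su tv a]]]]].
  case: tw => [M' [th' [v' [w' [tv' ww a']]]]].
  have [N [ps [m [m' [e e']]]]] := join_ex th th'.
  exists N, ps, (push m u), (push m' w').
  split; [exact: value_push su | exact: value_push ww |].
  have := annihilatedD (annihilated_push e a) (annihilatedD
    (value_uniq (value_push e tv) (value_push e' tv')) (annihilated_push e' a')).
  by rewrite -!scaleN1r !pushD !pushZ !scaleN1r !addrA !subrK.
- case: ss' => [M [th [u [v [su tv a]]]]].
  case: tt' => [M' [th' [u' [v' [su' tv' a']]]]].
  have [N [ps [m [m' [e e']]]]] := join_ex th th'.
  exists N, ps, (push m u + push m' u'), (push m v + push m' v'); split.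
  + by apply: value_cat; [apply: value_push su | apply: value_push su'].
  + by apply: value_cat; [apply: value_push tv | apply: value_push tv'].
  have := annihilatedD (annihilated_push e a) (annihilated_push e' a').
  by rewrite -!scaleN1r !pushD !pushZ !scaleN1r addrACA -opprD.
- have [M [th [u uP]]] := value_ex s; have [M' [th' [v vP]]] := value_ex t.
  have [N [ps [m [m' [e e']]]]] := join_ex th th'.
  apply: (same_valueI (th := ps) (u := push m u + push m' v)).
    by apply: value_cat; [apply: value_push uP | apply: value_push vP].
  rewrite addrC.
  by apply: value_cat; [apply: value_push vP | apply: value_push uP].
- apply: (same_valueI (th := y) (u := 0)) => //.
  by have := value1 0 (pull_id y); rewrite push0.
- apply: (same_valueI (th := y) (u := push (idm M) (x + x'))).
    by apply: value1; apply: pull_id.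
  rewrite pushD -[[:: _; _]]/([:: _] ++ [:: _]).
  by apply: value_cat; apply: value1; apply: pull_id.
- have [N [ps [m [m' [e e']]]]] := join_ex y y'.
  apply: (same_valueI (th := ps) (u := push (m + m') x)).
    by apply: value1; rewrite pullDm e e'.
  rewrite pushDm -[[:: _; _]]/([:: _] ++ [:: _]).
  by apply: value_cat; apply: value1.
- apply: (same_valueI (th := y) (u := push (idm M) (r *: x))).
    by apply: value1; apply: pull_id.
  have -> : push (idm M) (r *: x) = push (r *: idm M) x.
    by rewrite -[r *: idm M]addr0 push_linm push0m addr0 pushZ.
  (* The scalar r is absorbed by the stage map: r.id pulls y back to ry. *)
  apply: (value1 x).
  by rewrite -[r *: idm M]addr0 pull_linm pull0m addr0 pull_id.
- apply: (same_valueI (th := y) (u := push m x)); last exact: value1.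
  by have := value1 (push m x) (pull_id y); rewrite push_id.
Qed.

(** A pure tensor can only vanish by becoming annihilated at a later stage: it
    has the same value as the empty sum. *)
Lemma tens_eq0_push_annihilated M (x : F K M) (th : G M A) :
  tens x th = 0 ->
  exists (M' : C) (th' : G M' A) (m : Hom M M'),
    pull m th' = th /\ annihilated th' (push m x).
Proof.
rewrite -pmpi0 => /pmpiP/tens_eqv_same_value [M' [th' [u [v [/= su -> a]]]]].
case: su a => [m [u' [e -> ->]]] /=; rewrite !addr0 subr0 => a.
by exists M', th', m.
Qed.

Lemma tens_annihilated M (x : F K M) (th : G M A) :
  annihilated th x -> tens x th = 0.
Proof.
case=> [P [p [v [p0 ->]]]]; rewrite tens_bal p0.
by apply: (addrI (tens v (0 : G P A))); rewrite -tensD2 !addr0.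
Qed.

(** A sum of pure tensors over M and M' is a pure tensor over M ⊞ M'. *)
Lemma tens_pure (q : tensor F G K A) :
  exists (M : C) (x : F K M) (y : G M A), q = tens x y.
Proof.
elim/tens_ind: q => [|M x y _ [M' [x' [y' ->]]]].
  exists (zob C), 0, 0; apply/esym/tens_annihilated; exact: annihilated0.
exists (M ⊞ M'), (push (in1 M M') x + push (in2 M M') x'),
  (pull (pr1 M M') y + pull (pr2 M M') y').
by rewrite tensD1 !tens_bal pull_in1 pull_in2.
Qed.

End TensorKernel.

(** * Covariant exact sequences of an E-triangle *)

Section ExactSequences.
Variables (R : comPzRingType) (C : lincat R) (S : extriangulation C).

Lemma pull_deflation (A B K : C) (x : Hom A B) (y : Hom B K) (d : S K A) :
  rlz S x y d -> pull y d = 0.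
Proof.
move=> tri; have [a [<- _]] := ET3op (rlz_split S (zob C) B) tri
  (erefl (y ∘ pr2 (zob C) B)).
exact: push0.
Qed.

(** Compare the triangle with the split one on D and 0. *)
Lemma rlz_extend (A B K D : C) (x : Hom A B) (y : Hom B K) (d : S K A)
    (f : Hom A D) :
  rlz S x y d -> push f d = 0 -> exists k, f = k ∘ x.
Proof.
move=> tri f0.
have e : push f d = pull (0 : Hom K (zob C)) (0 : S (zob C) D).
  by rewrite f0 pull0.
have [b [eb _]] := rlz_mor tri (rlz_split S D (zob C)) e.
exists (pr1 D (zob C) ∘ b).
by rewrite -compA eb compA pr1_in1 comp_idl.
Qed.

(** If x_* h = 0 then x extends over the inflation realizing h, and the third
    component of the resulting map of triangles is the required c. *)
Lemma push_inflation_eq0 (A B K D : C) (x : Hom A B) (y : Hom B K)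
    (d : S K A) (h : S D A) :
  rlz S x y d -> push x h = 0 -> exists c : Hom D K, h = pull c d.
Proof.
move=> tri h0; have [P [x' [y' th]]] := rlz_ex h.
have [b eb] := rlz_extend th h0.
have [|c [ec _]] := ET3 th tri (a := idm A) (b := b).
  by rewrite comp_idr eb.
by exists c; rewrite -ec push_id.
Qed.

Definition half_exact (F : bimodule C) : Prop :=
  forall (D A B K : C) (x : Hom A B) (y : Hom B K) (d : S K A),
    rlz S x y d ->
    forall q : F D B, push y q = 0 -> exists q', q = push x q'.

(** Composing the inflation A -> B with the one realizing h produces, by (ET4), a
    triangle K -> E -> D realizing y_* h = 0.  It splits, and pulling the class
    over E back along the section lifts h. *)
Lemma half_exact_E1 : half_exact S.
Proof.
move=> D A B K x y d tri h yh0.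
have [P [g [g' th]]] := rlz_ex h.
have [E [_ [_ [k [e [d'' [_ [_ sp _ ed]]]]]]]] := ET4 tri th.
have [s es] : exists s, idm D = e ∘ s.
  by apply: rlz_lift sp _; rewrite yh0 pull0.
by exists (pull s d''); rewrite push_pull ed -pull_comp -es pull_id.
Qed.

(** The split triangle on M and M', up to the shear automorphism of the middle
    term that turns the projection to M' into (1, m). *)
Lemma shear_triangle (M M' : C) (m : Hom M M') :
  rlz S (in2 M' M - in1 M' M ∘ m) (pr1 M' M + m ∘ pr2 M' M) 0.
Proof.
apply/(rlz_class _ _ (rlz_split S M M')).
exists (in1 M' M ∘ (pr2 M M' - m ∘ pr1 M M') + in2 M' M ∘ pr1 M M'); split.
- exists (in1 M M' ∘ pr2 M' M + in2 M M' ∘ (pr1 M' M + m ∘ pr2 M' M)).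
  split; rewrite !biprodE.
    by rewrite subrK oplus_id.
  by rewrite addrK oplus_id.
- by rewrite !biprodE addrC.
- by rewrite !biprodE subrK.
Qed.

(** The pullback Q of p along m sits in a triangle Q -> P ⊞ M -> M' with second
    map (p, m), and its projection to M kills m^* th.  It is obtained from (ET4op)
    by composing p ⊞ 1 : P ⊞ M -> M' ⊞ M with the sheared projection to M'.  The
    middle term B is P ⊞ M only up to a zero summand, because the triangle on
    the identity of M is taken as the split triangle 0 -> 0 ⊞ M -> M; i1, i2 and
    p2 are the structure maps needed to compute in it. *)
Lemma homotopy_pullback (A P M M' : C) (x : Hom A P) (p : Hom P M')
    (th : S M' A) (m : Hom M M') :
  rlz S x p th ->
  exists (Q B : C) (h' : Hom Q B) (h : Hom B M') (d : S M' Q)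
      (i1 : Hom P B) (i2 : Hom M B) (p2 : Hom B M),
    [/\ rlz S h' h d, pull (p2 ∘ h') (pull m th) = 0,
        h ∘ i1 = p /\ h ∘ i2 = m & p2 ∘ i1 = 0 /\ p2 ∘ i2 = idm M].
Proof.
move=> tri.
have t1 := rlz_sum tri (rlz_split S (zob C) M).
have [Q [h' [h [k [e [d [[eh _ ef] [th' te _ _]]]]]]]] :=
  ET4op t1 (shear_triangle m).
exists Q, _, h', h, d, (in1 _ _), (in2 _ _ ∘ in2 _ _), (pr2 _ _ ∘ pr2 _ _).
(* e is the component of h' at M. *)
have e2 : pr2 (zob C) M ∘ pr2 P (zob C ⊞ M) ∘ h' = e.
  have /= := congr1 (comp (pr2 M' M)) ef.
  by rewrite /osum !biprodE.
split=> //; first last.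
- by rewrite !biprodE.
- by rewrite eh /osum !biprodE.
have := pull_deflation te; rewrite e2.
move/(congr1 (push (pr1 A (zob C)))); rewrite push0 /esum pull0 push0 addr0.
rewrite !push_pull -push_comp pr1_in1 push_id -!pull_comp !biprodE pullNm.
by move/eqP; rewrite oppr_eq0 => /eqP.
Qed.

(** If m_* u = p_* w, the element (-w, u) over P ⊞ M dies over M', so it lifts to
    the homotopy pullback, whose projection to M kills m^* th. *)
Lemma half_exact_annihilated (F : bimodule C) (K A M M' : C)
    (th : S M' A) (m : Hom M M') (u : F K M) :
  half_exact F -> annihilated th (push m u) -> annihilated (pull m th) u.
Proof.
move=> hF [P0 [p0 [w0 [p00 mu]]]].
have [P [x [p tri]]] := rlz_ex th.
have [k p0k] := rlz_lift tri p00.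
have [Q [B [h' [h [d [i1 [i2 [p2 [tQ q0 [hi1 hi2] [pi1 pi2]]]]]]]]]] :=
  homotopy_pullback m tri.
have [|v e] := hF _ _ _ _ _ _ _ tQ (push i2 u + push (- i1 ∘ k) w0).
  rewrite pushD -!push_comp hi2 !compA compNr hi1 compNl -p0k pushNm mu.
  by rewrite subrr.
exists Q, (p2 ∘ h'), v; split=> //.
rewrite push_comp -e pushD -!push_comp pi2 push_id compA compNr pi1.
by rewrite oppr0 comp0l push0m addr0.
Qed.

(** Exactness at the source of the connecting map given by th: a map killing th
    factors through the deflation of its triangle. *)
Lemma tens_eq0_annihilated (F : bimodule C) (K A M : C)
    (u : F K M) (th : S M A) :
  half_exact F -> tens u th = 0 -> annihilated th u.
Proof.
move=> hF /tens_eq0_push_annihilated [M' [th' [m [<- a]]]].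
exact: half_exact_annihilated.
Qed.

(** If the tensor of u and y_* h vanishes, u comes from v along a map p with
    p^* y_* h = 0; so p^* h lifts along x, and the tensor of v with the lift is
    the required preimage. *)
Lemma half_exact_tensor (F : bimodule C) :
  half_exact F -> half_exact (tensor F S).
Proof.
move=> hF D A B K x y d tri q.
have [M [u [h ->]]] := tens_pure q.
rewrite /= tens_push_tens => /(tens_eq0_annihilated hF) [P [p [v [p0 ->]]]].
rewrite -push_pull in p0.
have [h' e] := half_exact_E1 tri p0.
by exists (tens v h'); rewrite /= tens_push_tens tens_bal e.
Qed.

Lemma half_exact_Ext i : half_exact (Ext S i).
Proof.
rewrite /Ext; elim: i.-1 => [|j IH] /=; first exact: half_exact_E1.
exact: half_exact_tensor.
Qed.

(** Exactness at the target of the connecting map given by d; the argument is the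
    one for [half_exact_tensor], one place further along the sequence. *)
Lemma push_inflation_tensor_eq0 (F : bimodule C) (A B K : C) (x : Hom A B)
    (y : Hom B K) (d : S K A) D (q : tensor F S D A) :
  half_exact F -> rlz S x y d -> push x q = 0 ->
  exists z : F D K, q = tens z d.
Proof.
move=> hF tri; have [M [u [h ->]]] := tens_pure q.
rewrite /= tens_push_tens => /(tens_eq0_annihilated hF) [P [p [v [p0 ->]]]].
rewrite -push_pull in p0.
have [c e] := push_inflation_eq0 tri p0.
by exists (push c v); rewrite !tens_bal e.
Qed.

End ExactSequences.

(** * Maximal orthogonal subcategories and syzygies *)

Section Orthogonality.
Variables (R : comPzRingType) (C : lincat R) (S : extriangulation C).
Variables (X : addsubcat C) (n : nat).
Hypothesis Xn : max_orthogonal S n X.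

Lemma mem_right_perp A :
  X A <-> forall i, (1 <= i <= n)%N -> right_perp S i X A.
Proof. by case: Xn. Qed.

(** Idempotents of C need not split, so this does not follow from closure under
    direct summands; a right perpendicular, however, is closed under retracts. *)
Lemma max_orthogonal_retract (Y Z : C) (u : Hom Y Z) (v : Hom Z Y) :
  v ∘ u = idm Y -> X Z -> X Y.
Proof.
move=> vu /mem_right_perp Z0; apply/mem_right_perp => i le_in B XB e.
by rewrite -[e]push_id -vu push_comp [push u e]Z0 ?push0.
Qed.

(** Y is zero in the ideal quotient iff it belongs to X. *)
Lemma factors_id_mem (Y : C) : factors X (idm Y) <-> X Y.
Proof.
split=> [[Z [u [v [XZ e]]]]|XY]; first exact: max_orthogonal_retract (esym e) XZ.
by exists Y, (idm Y), (idm Y); rewrite comp_idl.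
Qed.

Lemma factors_source_mem (Y : C) : X Y <-> forall B (f : Hom Y B), factors X f.
Proof.
split=> [XY B f|fY]; last by apply/factors_id_mem.
by exists Y, (idm Y), f; rewrite comp_idr.
Qed.

Lemma factors_target_mem (Y : C) : X Y <-> forall B (f : Hom B Y), factors X f.
Proof.
split=> [XY B f|fY]; last by apply/factors_id_mem.
by exists Y, f, (idm Y); rewrite comp_idl.
Qed.

Lemma Ext_vanish_mem i : (1 <= i <= n)%N -> Ext_vanish S i X X.
Proof. by move=> le_in A B XA XB; apply: (mem_right_perp B).1. Qed.

Section Syzygy.
Variables (A : C) (t : right_triangle S X A).

(** A class on A^- dying in the middle term is pulled back along a map D -> A,
    which factors through the approximation and so gives the zero class. *)
Lemma Ext1_syzygy (D : C) : (1 <= n)%N -> X D ->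
  forall e : S D (rt_minus t), e = 0.
Proof.
move=> n1 XD e.
have XM := (rt_approx t).1.
have e0 : push (rt_in t) e = 0.
  by apply: (Ext_vanish_mem (i := 1)) => //; rewrite n1.
have [c ->] := push_inflation_eq0 (rt_rlz t) e0.
have [g ->] := (rt_approx t).2 _ c XD.
by rewrite pull_comp (pull_deflation (rt_rlz t)) pull0.
Qed.

Lemma ExtS_syzygy (D : C) i : (1 <= i < n)%N -> X D ->
  (forall e : Ext S i D A, e = 0) ->
  forall e : Ext S i.+1 D (rt_minus t), e = 0.
Proof.
case: i => [//|i] lt_in XD E0 e.
have e0 : push (E := Ext S i.+2) (rt_in t) e = 0.
  by apply: (Ext_vanish_mem (i := i.+2)) => //; apply: (rt_approx t).1.
have [z ->] :=
  push_inflation_tensor_eq0 (@half_exact_Ext _ _ S i.+1) (rt_rlz t) e0.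
by rewrite (E0 z); apply: tens_annihilated; apply: annihilated0.
Qed.

(** Injectivity of the connecting map: its kernel comes from E^i(D,X^A) = 0. *)
Lemma Ext_of_syzygy (D : C) i : (1 <= i <= n)%N -> X D ->
  (forall e : Ext S i.+1 D (rt_minus t), e = 0) ->
  forall e : Ext S i D A, e = 0.
Proof.
case: i => [//|i] le_in XD E0 e.
have := E0 (tens e (rt_ext t)).
case/(tens_eq0_annihilated (@half_exact_Ext _ _ S i.+1)) => P [p [v [p0 ->]]].
have [k ->] := rlz_lift (rt_rlz t) p0.
rewrite push_comp (_ : push k v = 0) ?push0 //.
by apply: (Ext_vanish_mem (i := i.+1)) => //; apply: (rt_approx t).1.
Qed.

End Syzygy.

Variable W : forall A : C, right_triangle S X A.

Definition syzygy (A : C) : C := rt_minus (W A).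

Lemma Ext_iter_syzygy k A i : (1 <= i <= k)%N -> (k <= n)%N ->
  right_perp S i X (iter k syzygy A).
Proof.
elim: k i => [|k IH] [|i] //= le_ik lt_kn D XD.
case: i le_ik => [|i] le_ik; first exact: Ext1_syzygy (leq_trans _ lt_kn) XD.
apply: ExtS_syzygy => //=; first exact: leq_trans lt_kn.
by apply: IH => //; apply: ltnW.
Qed.

Lemma iter_syzygy_in A : X (iter n syzygy A).
Proof.
by apply/mem_right_perp => i le_in; apply: Ext_iter_syzygy.
Qed.

Lemma Ext1_of_iter_syzygy k A : (k <= n)%N ->
  right_perp S k.+1 X (iter k syzygy A) -> right_perp S 1 X A.
Proof.
elim: k => //= k IH lt_kn E0; apply: IH (ltnW lt_kn) _ => D XD.
by apply: Ext_of_syzygy => // e; apply: E0.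
Qed.

(** A pure tensor in E^(i+1)(D,A) has its left factor in E^i(D,M). *)
Lemma Ext_vanish_of_Ext1 :
  (forall A, right_perp S 1 X A) -> forall i A, right_perp S i.+1 X A.
Proof.
move=> E0; elim=> [|i IH] A D XD e; first exact: E0.
have [M [u [y ->]]] := @tens_pure _ _ (Ext S i.+1) S _ _ e.
by rewrite (IH M D XD u); apply: tens_annihilated; apply: annihilated0.
Qed.

Lemma nonsplit_syzygy k : (k <= n)%N -> (1 <= n)%N -> nonsplit S ->
  ~ forall A, right_perp S k.+1 X (iter k syzygy A).
Proof.
move=> le_kn n1 [K [A [d nz]]] E0; apply: nz.
have XC B : X B.
  apply/mem_right_perp => -[//|i] _.
  by apply: Ext_vanish_of_Ext1 => D; apply: Ext1_of_iter_syzygy (E0 D).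
by apply: (Ext_vanish_mem (i := 1)); rewrite ?n1.
Qed.

(** * Comparison of syzygies and cosyzygies *)

Variable T : forall A : C, left_triangle S X A.

(** Maps f : A^+ -> B and a : A -> B^- correspond to each other as the outer
    components of maps of triangles (A -> X_A -> A^+) -> (B^- -> X^B -> B).  The
    classes satisfy a_* = f^*, and this common class is zero iff a factors
    through X, and also iff f does. *)
Lemma factors_cosyzygy_syzygy A B :
  (forall f : Hom (lt_plus (T A)) B, factors X f) <->
  (forall f : Hom A (syzygy B), factors X f).
Proof.
have [XA facA] := lt_approx (T A); have [XB facB] := rt_approx (W B).
split=> fX f.
  have [g eg] := facA _ (rt_in (W B) ∘ f) XB.
  have [c [e _]] := ET3 (lt_rlz (T A)) (rt_rlz (W B)) (esym eg).
  have [Z [u [v [XZ ec]]]] := fX c.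
  have [w ew] := facB _ v XZ.
  have [k ->] : exists k, f = k ∘ lt_in (T A).
    apply: rlz_extend (lt_rlz (T A)) _.
    by rewrite e ec ew !pull_comp (pull_deflation (rt_rlz (W B))) !pull0.
  by exists (lt_mid (T A)), (lt_in (T A)), k.
have [g eg] := facB _ (f ∘ lt_out (T A)) XA.
have [a [e _]] := ET3op (lt_rlz (T A)) (rt_rlz (W B)) (esym eg).
have [Z [u [v [XZ ea]]]] := fX a.
have [w ew] := facA _ u XZ.
have [k ->] : exists k, f = rt_out (W B) ∘ k.
  apply: rlz_lift (rt_rlz (W B)) _.
  by rewrite -e ea ew !push_comp (rlz_push0 (lt_rlz (T A))) !push0.
by exists (rt_mid (W B)), k, (rt_out (W B)).
Qed.

Definition cosyzygy (A : C) : C := lt_plus (T A).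

Lemma factors_cosyzygy_syzygy_iter m A B :
  (forall f : Hom (iter m cosyzygy A) B, factors X f) <->
  (forall f : Hom A (iter m syzygy B), factors X f).
Proof.
elim: m B => //= m IH B.
by rewrite factors_cosyzygy_syzygy IH -iterSr.
Qed.

Lemma iter_cosyzygyP m :
  (forall A, X (iter m cosyzygy A)) <-> (forall A, X (iter m syzygy A)).
Proof.
split=> XA A.
  apply/factors_target_mem => B; apply/factors_cosyzygy_syzygy_iter.
  exact: (factors_source_mem _).1.
apply/factors_source_mem => B; apply/factors_cosyzygy_syzygy_iter.
exact: (factors_target_mem _).1.
Qed.

Lemma powfun_suspensionE m A : powfun (suspension T) m A = iter m cosyzygy A.
Proof. by elim: m => //= m ->. Qed.

(** Between zero objects any map is an isomorphism and any square commutes, so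
    only the objects matter. *)
Lemma powfun_suspension_eq0 m :
  natiso (powfun (suspension T) m) (zerofun (ideal_quotient X)) <->
  forall A, X (iter m cosyzygy A).
Proof.
split=> [[phi [_ phi_iso]] A|XA].
  rewrite -powfun_suspensionE; apply/factors_id_mem.
  have [g [e _]] := phi_iso A.
  have /qpiP : qpi X (idm (powfun (suspension T) m A : C)) = qpi X 0.
    by rewrite -[LHS]e (zob_initial g) comp0l.
  by rewrite subr0.
exists (fun=> 0); split=> [A B f|A]; first by rewrite comp0l comp0r.
exists 0; rewrite !comp0l; split; last by rewrite [RHS]zob_initial.
apply/esym/qpiP; rewrite subr0; apply/factors_id_mem.
by have := XA A; rewrite -powfun_suspensionE.
Qed.

End Orthogonality.

Theorem theorem1p4 (R : comPzRingType) (n : nat) (C : lincat R)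
    (S : extriangulation C) (X : addsubcat C)
    (T : forall A : C, left_triangle S X A) :
  (1 <= n)%N ->
  nonsplit S ->
  strongly_functorially_finite S X ->
  max_orthogonal S n X ->
  nilpotency_index (suspension T) = Some n /\ ~ Ext_vanish S n.+1 X X.
Proof.
move=> n1 nsp sff Xn.
pose W A := inhabited_witness (sff A).2.
have kills_suspensionP m : kills (suspension T) m <->
    (0 < m)%N /\ forall A, X (iter m (syzygy W) A).
  rewrite -(iter_cosyzygyP Xn W T) -(powfun_suspension_eq0 Xn) /kills.
  by split=> [/andP[-> /asboolP]|[-> ?]] //; apply/asboolP.
have kn : kills (suspension T) n.
  by apply/kills_suspensionP; split=> // A; apply: iter_syzygy_in.
split.
  rewrite /nilpotency_index; case: pselect => [h|[]]; last by exists n.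
  congr Some; case: ex_minnP => m /kills_suspensionP [m0 Xm] le_m; apply/eqP.
  rewrite eqn_leq le_m // leqNgt; apply/negP => lt_mn.
  apply: (nonsplit_syzygy Xn (W := W) (ltnW lt_mn) n1 nsp) => A.
  exact: (mem_right_perp Xn _).1.
move=> E0; apply: (nonsplit_syzygy Xn (W := W) (leqnn n) n1 nsp) => A D XD.
by apply: E0 => //; apply: iter_syzygy_in.
Qed.
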